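(* Let $\mathcal{C}$ be an unmixed totally balanced clutter with vertex set $X$. If $\mathcal{C}$ has no isolated vertices and $g$ is the height of $I(\mathcal{C})$, then: (a) $\mathcal{C}$ has a perfect matching $e_1,\ldots,e_g$ of König type such that $e_i$ has a free vertex for all $i$. (b) $\Delta_{\mathcal{C}}$ is a pure shellable simplicial complex. (c) $\mathcal{C}$ is the clutter of maximal cliques of a perfect graph $G$. (d) The set of non-free vertices of $e_i$ is contained in a maximal clique of $G$ (for each $i$, with $e_i$ as in (a) and $G$ as in (c)). (e) If $\mathcal{C}$ is uniform, there is a partition $X^1,\ldots,X^d$ of $X$ such that any edge of $\mathcal{C}$ intersects any $X^i$ in exactly one vertex.
   Context: A clutter $\mathcal{C}$ with finite vertex set $X=\{x_1,\ldots,x_n\}$ is a family $E(\mathcal{C})$ of subsets of $X$, called edges, none of which is included in another. It is uniform if all its edges have the same size. A vertex is isolated if it occurs in no edge, and free if it occurs in exactly one edge. The edge ideal $I(\mathcal{C})$ is the ideal of the polynomial ring $K[x_1,\ldots,x_n]$ over a field $K$ generated by the monomials $\prod_{x_i\in e}x_i$, $e\in E(\mathcal{C})$. A vertex cover of $\mathcal{C}$ is a subset of $X$ meeting every edge; it is minimal if no proper subset is a vertex cover. The height of $I(\mathcal{C})$ equals the minimum size of a vertex cover. $\mathcal{C}$ is unmixed if all its minimal vertex covers have the same size. A perfect matching of König type of $\mathcal{C}$ is a collection $e_1,\ldots,e_g$ of pairwise disjoint edges whose union is $X$ and such that $g$ is the height of $I(\mathcal{C})$. $\Delta_{\mathcal{C}}$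 is the simplicial complex on $X$ whose faces are the independent vertex sets of $\mathcal{C}$, i.e. the subsets of $X$ containing no edge of $\mathcal{C}$ (the Stanley-Reisner complex of $I(\mathcal{C})$). A simplicial complex is pure if all its facets (maximal faces) have the same number of elements. It is shellable if its facets can be ordered $F_1,\ldots,F_s$ such that for all $1\leq i<j\leq s$ there exist some $v\in F_j\setminus F_i$ and some $\ell\in\{1,\ldots,j-1\}$ with $F_j\setminus F_\ell=\{v\}$. It is pure shellable if it is both pure and shellable. The incidence matrix of $\mathcal{C}$, with edges $g_1,\ldots,g_q$, is $A=(a_{ij})$ with $a_{ij}=1$ if $x_i\in g_j$ and $a_{ij}=0$ otherwise. $\mathcal{C}$ has a cycle of length $r$ if there is a square submatrix of $A$ of order $r\geq 3$ with exactly two $1$'s in each row and column. $\mathcal{C}$ is totally balanced if it is acyclic, i.e. it has no cycles of any length $r\geq 3$. A clique of a graph $G$ is a set of vertices inducing a complete subgraph; the clutter of maximal cliques of $G$ has as vertex set the vertex set of $G$ and as edges the inclusion-maximal cliques of $G$. The chromatic number of a graph is the minimal number of colours in an assignment of colours to its vertices in which adjacent vertices have distinct colours. A graph is perfect if for every induced subgraph $H$ the chromatic number of $H$ equals the size of the largest complete subgraph of $H$. *)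

(* Defs.v *)
From mathcomp Require Import all_boot all_order all_algebra.
From mathcomp Require Import mpoly.

Set Implicit Arguments.
Unset Strict Implicit.
Unset Printing Implicit Defensive.

Import GRing.Theory.
Local Open Scope ring_scope.

Section Ideals.
Variable R : comNzRingType.
Implicit Types (I P : R -> Prop) (Q : nat -> R -> Prop).

Definition is_ideal I : Prop :=
  [/\ I 0, forall a b, I a -> I b -> I (a + b) & forall a b, I b -> I (a * b)].

Definition prime_ideal P : Prop :=
  [/\ is_ideal P, ~ P 1 & forall a b, P (a * b) -> P a \/ P b].

Definition ideal_le I P : Prop := forall a, I a -> P a.

(* A strict chain Q 0 < Q 1 < ... < Q k = P of prime ideals. *)
Definition prime_chain P k : Prop :=
  exists Q,
    [/\ forall i, (i <= k)%N -> prime_ideal (Q i),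
        forall i, (i < k)%N -> ideal_le (Q i) (Q i.+1) /\ ~ ideal_le (Q i.+1) (Q i)
      & forall a, Q k a <-> P a].

Definition prime_height P h : Prop :=
  prime_chain P h /\ (forall k, prime_chain P k -> (k <= h)%N).

(* The minimum of the heights of the primes containing I; the relation holds
   for no h when I is the unit ideal. *)
Definition ideal_height I h : Prop :=
  (exists P, [/\ prime_ideal P, ideal_le I P & prime_height P h]) /\
  (forall P k, prime_ideal P -> ideal_le I P -> prime_height P k -> (h <= k)%N).

End Ideals.

Section Clutters.
Variable T : finType.
Implicit Types (E : {set {set T}}) (C S : {set T}) (x : T).

Definition is_clutter E : Prop := forall e f : {set T}, e \in E -> f \in E -> e \subset f -> e = f.

Definition uniform E : Prop := forall e f : {set T}, e \in E -> f \in E -> #|e| = #|f|.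

Definition isolated_vertex E x : bool := [forall e in E, x \notin e].

Definition free_vertex E x : bool := #|[set e in E | x \in e]| == 1%N.

Definition vertex_cover E C : bool := [forall e in E, C :&: e != set0].

Definition unmixed E : Prop :=
  forall C C', minset (vertex_cover E) C -> minset (vertex_cover E) C' ->
    #|C| = #|C'|.

Definition independent E S : bool := [forall e in E, ~~ (e \subset S)].

(* The complex Delta_C, given by its set of faces. *)
Definition independence_complex E : {set {set T}} := [set S | independent E S].

End Clutters.

Section IncidenceMatrix.
Variable n : nat.
Implicit Type E : {set {set 'I_n}}.

Definition incidence_matrix E : 'M[nat]_(n, #|E|) :=
  \matrix_(i < n, j < #|E|) nat_of_bool (i \in (enum_val j : {set 'I_n})).

Definition two_ones_per_line r (B : 'M[nat]_r) : Prop :=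
  (forall i, #|[set j | B i j == 1%N]| = 2%N) /\
  (forall j, #|[set i | B i j == 1%N]| = 2%N).

Definition has_cycle E r : Prop :=
  (3 <= r)%N /\
  exists (rows : 'I_r -> 'I_n) (cols : 'I_r -> 'I_#|E|),
    [/\ injective rows, injective cols
      & two_ones_per_line (mxsub rows cols (incidence_matrix E))].

Definition totally_balanced E : Prop := forall r, ~ has_cycle E r.

End IncidenceMatrix.

Section EdgeIdeal.
Variables (K : fieldType) (n : nat).
Implicit Type E : {set {set 'I_n}}.

Definition edge_monomial (e : {set 'I_n}) : {mpoly K[n]} := \prod_(i in e) 'X_i.

Definition edge_ideal E (p : {mpoly K[n]}) : Prop :=
  exists c : {set 'I_n} -> {mpoly K[n]}, p = \sum_(e in E) c e * edge_monomial e.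

Definition konig_perfect_matching E g (e : 'I_g -> {set 'I_n}) : Prop :=
  [/\ forall i, e i \in E,
      forall i j, i != j -> [disjoint e i & e j],
      \bigcup_i e i = [set: 'I_n]
    & ideal_height (edge_ideal E) g].

End EdgeIdeal.

Section SimplicialComplexes.
Variable T : finType.
Implicit Types (D : {set {set T}}) (F : {set T}).

Definition simplicial_complex D : Prop :=
  forall F F', F \in D -> F' \subset F -> F' \in D.

Definition facets D : {set {set T}} := [set F | maxset (fun F' => F' \in D) F].

Definition pure D : Prop := forall F F', F \in facets D -> F' \in facets D -> #|F| = #|F'|.

Definition shellable D : Prop :=
  exists s : seq {set T},
    [/\ uniq s, s =i facets D
      & forall i j, (i < j < size s)%N ->
          exists v l, [/\ v \in nth set0 s j :\: nth set0 s i, (l < j)%N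
                        & nth set0 s j :\: nth set0 s l = [set v]]].

Definition pure_shellable_complex D : Prop :=
  [/\ simplicial_complex D, pure D & shellable D].

End SimplicialComplexes.

Section Graphs.
Variable T : finType.
Implicit Types (G : rel T) (A Q : {set T}).

Definition simple_graph G : Prop := ssrbool.symmetric G /\ irreflexive G.

(* The empty set is not a clique, so the graph without vertices has an empty
   clutter of maximal cliques; for all other graphs this makes no difference
   to the maximal cliques. *)
Definition clique G Q : bool :=
  (Q != set0) && [forall x in Q, forall y in Q, (x != y) ==> G x y].

Definition maximal_clique G Q : bool := maxset (clique G) Q.

Definition maximal_clique_clutter G : {set {set T}} :=
  [set Q | maximal_clique G Q].

Definition clique_number G : nat := \max_(Q : {set T} | clique G Q) #|Q|.

(* Comparing distinct vertices only makes this well behaved for every G;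
   on a simple graph the condition x != y is implied by G x y. *)
Definition colourable G k : bool :=
  [exists c : {ffun T -> 'I_k},
     [forall x, forall y, (x != y) && G x y ==> (c x != c y)]].

Lemma ex_colourable G : exists k, colourable G k.
Proof.
exists #|T|; apply/existsP; exists [ffun x => enum_rank x].
apply/forallP => x; apply/forallP => y; apply/implyP => /andP[xy _].
by rewrite !ffunE (inj_eq enum_rank_inj).
Qed.

Definition chromatic_number G : nat := ex_minn (ex_colourable G).

End Graphs.

Definition induced (T : finType) (G : rel T) (A : {set T}) : rel {x : T | x \in A} :=
  fun x y => G (val x) (val y).

Definition perfect (T : finType) (G : rel T) : Prop :=
  forall A : {set T},
    chromatic_number (induced G (A := A)) = clique_number (induced G (A := A)).

(* Main.v *)
Require Import Defs.
From mathcomp Require Import all_boot all_order all_algebra.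
From mathcomp Require Import mpoly.
From mathcomp Require Import fingroup perm zify ring.
From Stdlib Require Import ClassicalEpsilon.

Set Implicit Arguments.
Unset Strict Implicit.
Unset Printing Implicit Defensive.

Import GRing.Theory.

(** Since [edge_ideal E] is a monomial ideal, its height is the least size of a
    vertex cover; everything else is combinatorics of clutters.

    Height.  A prime containing the edge ideal contains, for some vertex cover
    [S], the ideal generated by the variables of [S], so one needs the height of
    that ideal to be exactly [#|S|].  The lower bound is the chain obtained by
    adding the variables one by one.  For the upper bound, a chain below it is
    prolonged by adding the other variables, and no chain of primes of
    K[x_1, ..., x_n] is longer than [n]: given a longer one, choose
    [f i] in the prime number [i.+1] but not in the prime number [i]; more than [n] polynomials
    satisfy an algebraic relation, and cancelling powers of [f 0], then of
    [f 1], and so on pushes a nonzero constant into the last prime.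

    Ordering.  The incidence matrix of [E] has a doubly lexical ordering, and in
    such an ordering a 2 x 2 submatrix with its only 0 in the last corner could
    be prolonged to a cycle ([lexical_gamma_free]).  So vertices and edges carry
    orders [p] and [q] for which, when [e] precedes [f] and both contain [x],
    all vertices of [e] after [x] lie in [f] ([gamma_free_order]).  Two greedy
    procedures exploit this.  Picking edges in the order [q] yields disjoint
    edges whose last vertices form a vertex cover; by unmixedness every minimal
    vertex cover then has one vertex on each of these edges, and they cover all
    vertices.  Colouring vertices backwards along [p] shows that the graph
    joining two vertices of a common edge is perfect, because the later
    neighbours of a vertex form a clique.

    Traces.  Let [e] be an edge of the matching.  If [f] and [f'] are edges
    whose traces on [e] are not nested, unmixedness provides a further edge
    which closes a cycle of length 3 or 4 ([nested_traces]).  Hence a vertex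
    outside a largest proper trace on [e] is free.  Moreover, within [e],
    replacing a vertex of a cover by one of larger degree keeps the cover; this
    exchange gives the shelling, facets being complements of minimal covers.

    Finally, the absence of 3-cycles makes every clique of the graph lie in an
    edge ([clique_sub_edge]), and in the uniform case each edge meets every
    colour of an optimal colouring exactly once. *)

(** * Chains of primes in polynomial rings *)

Section PrimeChains.
Local Open Scope ring_scope.
Variable R : comNzRingType.
Implicit Types (I P : R -> Prop) (Q : nat -> R -> Prop).

Lemma ideal_sum I (J : finType) (S : {pred J}) (F : J -> R) :
  is_ideal I -> (forall j, j \in S -> I (F j)) -> I (\sum_(j in S) F j).
Proof. by case=> I0 ID _ IF; apply: (big_ind I). Qed.

Lemma ideal_sub I a b : is_ideal I -> I a -> I b -> I (a - b).
Proof. by case=> _ ID IM Ia Ib; apply: ID => //; rewrite -mulN1r; apply: IM. Qed.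

Lemma prime_exp P a k : prime_ideal P -> P (a ^+ k) -> P a.
Proof.
case=> _ P1 PM; elim: k => [|k IH]; first by rewrite expr0.
by rewrite exprS => /PM[].
Qed.

Lemma prime_prod P (J : finType) (S : {pred J}) (F : J -> R) :
  prime_ideal P -> P (\prod_(j in S) F j) -> exists2 j, j \in S & P (F j).
Proof.
case=> _ P1 PM; apply: (big_rec (fun q => P q -> exists2 j, j \in S & P (F j))) => //.
by move=> j q jS IH /PM[PFj|/IH//]; exists j.
Qed.

(** Among the exponents occurring in a relation, those with the least exponent
    of [f 0] survive modulo [Q 1] once that power of [f 0] is cancelled, which is
    legitimate modulo the prime [Q 0].  Iterating along the chain isolates a
    single coefficient, which then lies in [Q m]. *)
Lemma chain_no_relation m N Q (f : nat -> R) (c : {ffun 'I_m -> 'I_N} -> R) :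
    (forall i, (i <= m)%N -> prime_ideal (Q i)) ->
    (forall i, (i < m)%N ->
       [/\ ideal_le (Q i) (Q i.+1), Q i.+1 (f i) & ~ Q i (f i)]) ->
    (forall a, c a != 0 -> ~ Q m (c a)) ->
    (exists a, c a != 0) ->
  \sum_a c a * \prod_(i < m) f i ^+ a i <> 0.
Proof.
move=> Qprime Qf Qc [a1 ca1] rel0.
have step k : (k <= m)%N -> exists S : {set {ffun 'I_m -> 'I_N}},
    [/\ S != set0, forall a, a \in S -> c a != 0,
        forall a b (i : 'I_m), a \in S -> b \in S -> (i < k)%N -> a i = b i
      & Q k (\sum_(a in S) c a * \prod_(i < m | (k <= i)%N) f i ^+ a i)].
  elim: k => [_|k IH km].
    exists [set a | c a != 0]; split=> //; first by apply/set0Pn; exists a1; rewrite inE.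
      by move=> a; rewrite inE.
    have [[Q0 _ _] _ _] := Qprime 0 (leq0n m).
    rewrite big_mkcond /=; rewrite (eq_bigr (fun a => c a * \prod_(i < m) f i ^+ a i)).
      by rewrite rel0.
    move=> a _; rewrite inE; case: eqP => [->|_]; first by rewrite mul0r.
    by congr (_ * _).
  have [S [/set0Pn[b bS] Sc Seq QS]] := IH (ltnW km).
  pose ik := Ordinal km.
  have [a0 a0S a0min] : exists2 a0, a0 \in S & forall a, a \in S -> (a0 ik <= a ik)%N.
    case: (arg_minnP (fun a : {ffun 'I_m -> 'I_N} => a ik : nat) bS) => a0 a0S a0min.
    by exists a0.
  have [Qle Qfk Qnfk] := Qf k km.
  have Qk := Qprime k (ltnW km); have Qk1 := Qprime k.+1 km.
  have [Qk1id _ _] := Qk1; have [_ _ Qk1M] := Qk1id.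
  pose F (a : {ffun 'I_m -> 'I_N}) := \prod_(i < m | (k.+1 <= i)%N) f i ^+ a i.
  (* The least power of f k occurring in the relation can be cancelled. *)
  have Qdiv : Q k.+1 (\sum_(a in S) c a * (f k ^+ (a ik - a0 ik)%N * F a)).
    apply: Qle; have [_ _ QkM] := Qk.
    suff /QkM[/(prime_exp Qk)//|//] :
      Q k (f k ^+ a0 ik * \sum_(a in S) c a * (f k ^+ (a ik - a0 ik)%N * F a)).
    rewrite mulr_sumr; move: QS; congr (Q k _); apply: eq_bigr => a aS.
    rewrite (bigD1 ik) //= [RHS]mulrCA; congr (_ * _).
    rewrite [RHS]mulrA -exprD subnKC ?a0min //; congr (_ * _); apply: eq_bigl => i.
    by rewrite -val_eqE /= ltn_neqAle andbC eq_sym.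
  exists [set a in S | a ik == a0 ik]; split.
  - by apply/set0Pn; exists a0; rewrite inE a0S eqxx.
  - by move=> a; rewrite inE => /andP[/Sc].
  - move=> a a' i; rewrite !inE => /andP[aS /eqP ak] /andP[a'S /eqP a'k].
    rewrite ltnS leq_eqVlt => /orP[/eqP ik_eq|]; last exact: Seq.
    by rewrite (val_inj (ik_eq : val i = val ik)) ak a'k.
  move: Qdiv; rewrite (bigID (fun a : {ffun 'I_m -> 'I_N} => a ik == a0 ik)) /=.
  set s1 := (X in X + _); set s2 := (X in _ + X) => Qdiv.
  have -> : \sum_(a in [set a in S | a ik == a0 ik]) c a * F a = s1.
    rewrite /s1; apply: eq_big => [a|a]; first by rewrite inE.
    by rewrite inE => /andP[_ /eqP->]; rewrite subnn expr0 mul1r.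
  rewrite -[s1](addrK s2); apply: (ideal_sub Qk1id Qdiv).
  apply: (ideal_sum (S := [pred a | (a \in S) && (a ik != a0 ik)])) => // a.
  rewrite inE => /andP[aS]; rewrite neq_ltn ltnNge a0min //= => lt_a.
  rewrite -(subnSK lt_a) exprS mulrCA -mulrA mulrC; exact: Qk1M.
have [S [/set0Pn[a aS] Sc Seq QS]] := step m (leqnn m).
have S1 : S = [set a].
  apply/setP => b; rewrite inE; apply/idP/eqP => [bS|->//].
  by apply/ffunP => i; apply: Seq.
apply: (Qc a (Sc a aS)); move: QS; rewrite S1 big_set1 big_pred0 ?mulr1 // => i.
by rewrite leqNgt ltn_ord.
Qed.

End PrimeChains.

Section Dimension.
Local Open Scope ring_scope.
Variable K : fieldType.

(** The matrix [M] has more rows than columns, hence a nonzero left kernel. *)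
Lemma linear_dependence (I J : finType) (M : I -> J -> K) :
    (#|J| < #|I|)%N ->
  exists2 c : I -> K, exists i, c i != 0 & forall j, \sum_i c i * M i j = 0.
Proof.
move=> ltJI; pose A := \matrix_(i < #|I|, j < #|J|) M (enum_val i) (enum_val j).
have : ~~ row_free A by rewrite -row_leq_rank -ltnNge (leq_ltn_trans (rank_leq_col A)).
rewrite -kermx_eq0 => /rowV0Pn[v /sub_kermxP vA v0].
exists (fun i => v 0 (enum_rank i)).
  have /existsP[i vi] : [exists i, v 0 i != 0].
    apply: contraR v0; rewrite negb_exists => /forallP v0.
    by apply/eqP/rowP => i; rewrite mxE; apply/eqP; rewrite -[_ == _]negbK v0.
  by exists (enum_val i); rewrite enum_valK.
move=> j; have /rowP/(_ (enum_rank j)) := vA; rewrite !mxE => {2}<-.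
rewrite (reindex_onto (@enum_val I predT) (@enum_rank I)) /=; last first.
  by move=> i _; rewrite enum_rankK.
rewrite (eq_bigl predT) => [|i]; last by rewrite enum_valK eqxx.
by apply: eq_bigr => i _; rewrite enum_valK !mxE enum_rankK.
Qed.

Variable n : nat.
Implicit Type p : {mpoly K[n]}.

Lemma msize_prod_le (J : finType) (F : J -> {mpoly K[n]}) (D : J -> nat) :
    (forall j, (msize (F j) <= (D j).+1)%N) ->
  (msize (\prod_j F j) <= (\sum_j D j).+1)%N.
Proof.
move=> FD; apply: (big_ind2 (fun p d => (msize p <= d.+1)%N)) => //.
  by rewrite msize1.
move=> p d q e pd qe; have [->|p0] := eqVneq p 0; first by rewrite mul0r msize0.
have [->|q0] := eqVneq q 0; first by rewrite mulr0 msize0.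
rewrite msizeM // -subn1 leq_subLR; apply: leq_trans (leq_add pd qe) _; lia.
Qed.

Lemma msize_exp_le p d a : (msize p <= d.+1)%N -> (msize (p ^+ a) <= (a * d).+1)%N.
Proof.
move=> pd; rewrite -[a in p ^+ a]card_ord -prodr_const.
rewrite -[a in (a * d)%N]card_ord -sum_nat_const.
exact: (@msize_prod_le 'I_a (fun=> p) (fun=> d)).
Qed.

Lemma card_bmultinom D : (#|{: 'X_{1..n < D}}| <= D ^ n)%N.
Proof.
have bound (m : 'X_{1..n < D}) (i : 'I_n) : (m i < D)%N.
  by apply: leq_ltn_trans (bmdeg m); rewrite mdegE (bigD1 i) //= leq_addr.
pose h (m : 'X_{1..n < D}) := [ffun i : 'I_n => Ordinal (bound m i)].
rewrite -[D in (D ^ n)%N]card_ord -[n in (_ ^ n)%N]card_ord -card_ffun.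
apply: (@leq_card _ _ h) => m1 m2 /ffunP eq_h; apply/val_inj/mnmP => i.
by have := eq_h i; rewrite !ffunE => /(congr1 val).
Qed.

(** Exponents below [N] give [N ^ n.+1] products, all of degree less than [D],
    where the space of polynomials has dimension at most [D ^ n]; as [D] grows
    linearly with [N], the products are dependent for large [N]. *)
Lemma algebraic_dependence (f : nat -> {mpoly K[n]}) :
  exists N, exists2 c : {ffun 'I_n.+1 -> 'I_N} -> K, exists a, c a != 0
    & \sum_a (c a)%:MP * \prod_(i < n.+1) f i ^+ a i = 0.
Proof.
pose d := (\max_(i < n.+1) msize (f i))%N.
(* [D <= N * (n.+1 * d).+1], so [N > (n.+1 * d).+1 ^ n] forces [D ^ n < N ^ n.+1]. *)
pose N := ((n.+1 * d).+1 ^ n).+1; pose D := (n.+1 * (N * d)).+1.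
have msD (a : {ffun 'I_n.+1 -> 'I_N}) :
    (msize (\prod_(i < n.+1) f i ^+ a i) <= D)%N.
  apply: leq_trans (msize_prod_le (D := fun i : 'I_n.+1 => (N * d)%N) _) _.
    move=> i; apply: leq_trans (msize_exp_le (d := d) _ _) _.
      by apply: leqW; rewrite /d; exact: (leq_bigmax i).
    by rewrite ltnS leq_mul2r ltnW ?orbT.
  by rewrite sum_nat_const card_ord.
have [|c c0 cM] := @linear_dependence {ffun 'I_n.+1 -> 'I_N} 'X_{1..n < D}
    (fun a m => (\prod_(i < n.+1) f i ^+ a i)@_m).
  rewrite card_ffun !card_ord; apply: leq_ltn_trans (card_bmultinom D) _.
  apply: (@leq_ltn_trans ((N * (n.+1 * d).+1) ^ n)%N).
    have DN : (D <= N * (n.+1 * d).+1)%N by rewrite mulnS /D mulnCA addnC -addn1 leq_add2l.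
    have mono x y k : (x <= y -> x ^ k <= y ^ k)%N.
      by move=> xy; elim: k => // k IH; rewrite !expnS leq_mul.
    exact: mono.
  by rewrite expnMn expnS mulnC ltn_mul2r expn_gt0 /= /N ltnSn.
exists N; exists c => //; apply/mpolyP => m; rewrite mcoeff0 raddf_sum /=.
under eq_bigr => a _ do rewrite mcoeffCM.
have [mD|Dm] := ltnP (mdeg m) D; first exact: (cM (BMultinom mD)).
rewrite big1 // => a _; rewrite (_ : _@_m = 0) ?mulr0 //.
by apply/eqP; rewrite mcoeff_eq0 msize_mdeg_ge // (leq_trans (msD a)).
Qed.

(** Elements separating the consecutive primes of a chain are algebraically
    independent, so there are at most [n] of them. *)
Lemma prime_chain_le (P : {mpoly K[n]} -> Prop) k : prime_chain P k -> (k <= n)%N.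
Proof.
case=> Q [Qprime Qlt _]; rewrite leqNgt; apply/negP => nk.
have [f Qf] : exists f : nat -> {mpoly K[n]},
    forall i, (i < k)%N -> Q i.+1 (f i) /\ ~ Q i (f i).
  apply: (@choice nat _ (fun i p => (i < k)%N -> Q i.+1 p /\ ~ Q i p)) => i.
  have [ik|] := ltnP i k; last by exists 0.
  have [_ nle] := Qlt i ik; apply: NNPP => none; apply: nle => p Qp.
  by apply: NNPP => nQp; apply: none; exists p.
have [N [c [a ca]]] := algebraic_dependence f.
apply: (chain_no_relation (Q := Q)) => [i ik|i ik|b cb Qb|].
- exact/Qprime/(leq_trans ik).
- have ik' := leq_trans ik nk; have [? ?] := Qf i ik'.
  by split=> //; have [] := Qlt i ik'.
- have [[_ _ QM] Q1 _] := Qprime n.+1 nk; apply: Q1.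
  rewrite -mpolyC1 -(mulVf (x := c b)); last by rewrite -(mpolyC_eq0 n).
  by rewrite mpolyCM; apply: QM.
- by exists a; rewrite mpolyC_eq0.
Qed.

Definition kill (S : {set 'I_n}) : {mpoly K[n]} -> {mpoly K[n]} :=
  mmap (@mpolyC n K) (fun i => if i \in S then 0 else 'X_i).

(** The ideal generated by the variables in [S], given as a kernel so that it
    is visibly prime. *)
Definition var_ideal (S : {set 'I_n}) p : Prop := kill S p = 0.

Lemma killX S i : kill S 'X_i = if i \in S then 0 else 'X_i.
Proof. by rewrite /kill mmapX mmap1U. Qed.

Lemma var_ideal_prime S : prime_ideal (var_ideal S).
Proof.
rewrite /var_ideal; split; first split.
- by rewrite /kill mmap0.
- by move=> p q p0 q0; rewrite /kill mmapD -!/(kill S _) p0 q0 addr0.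
- by move=> p q q0; rewrite /kill rmorphM /= -!/(kill S _) q0 mulr0.
- by rewrite /kill rmorph1; apply/eqP/oner_neq0.
by move=> p q /eqP; rewrite /kill rmorphM /= mulf_eq0 => /orP[]/eqP; [left|right].
Qed.

Lemma var_idealX S i : var_ideal S 'X_i <-> i \in S.
Proof.
rewrite /var_ideal killX; case: ifP => // _; split=> // /(congr1 (mcoeff U_(i)%MM)).
by rewrite mcoeffX mcoeff0 eqxx => /eqP; rewrite oner_eq0.
Qed.

(** Killing a variable of [P] does not change a polynomial modulo [P]. *)
Lemma var_ideal_le (S : {set 'I_n}) (P : {mpoly K[n]} -> Prop) :
  is_ideal P -> (forall i, i \in S -> P 'X_i) -> ideal_le (var_ideal S) P.
Proof.
move=> Pid PX p Sp; have [P0 PD PM] := Pid.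
suff : P (p - kill S p) by rewrite Sp subr0.
have Pmul q r : P (q - kill S q) -> P (r - kill S r) -> P (q * r - kill S (q * r)).
  rewrite {3}/kill rmorphM /= -!/(kill S _) => Pq Pr.
  have -> : q * r - kill S q * kill S r =
            q * (r - kill S r) + kill S r * (q - kill S q).
    by ring.
  by apply: PD; apply: PM.
have Pc c : P (c%:MP - kill S c%:MP) by rewrite /kill mmapC subrr.
have PXm m : P ('X_[m] - kill S 'X_[m]).
  rewrite mpolyXE_id; apply: (big_ind (fun q => P (q - kill S q))) => //.
    by rewrite -mpolyC1.
  move=> i _; elim: (m i) => [|e IH]; first by rewrite expr0 -mpolyC1.
  rewrite exprS; apply: Pmul => //; rewrite killX; case: ifP => iS.
    by rewrite subr0; apply: PX.
  by rewrite subrr.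
elim/mpolyind: p {Sp} => [|c m p _ _ IH]; first by rewrite /kill mmap0 subrr.
rewrite /kill mmapD -!/(kill S _) opprD addrACA; apply: PD => //.
by rewrite -mul_mpolyC; apply: Pmul.
Qed.

(** The chain consists of the ideals of the first [k] variables of [S], with
    [P] itself replacing the last one. *)
Lemma var_chain (P : {mpoly K[n]} -> Prop) (S : {set 'I_n}) :
  prime_ideal P -> (forall i, i \in S -> P 'X_i) -> prime_chain P #|S|.
Proof.
move=> Pp PX; have [Pid _ _] := Pp.
pose V k := [set i in take k (enum S)].
have VS k : V k \subset S.
  by apply/subsetP => i; rewrite inE => /mem_take; rewrite mem_enum.
exists (fun k => if (k < #|S|)%N then var_ideal (V k) else P); split.
- by move=> i _; case: ifP => // _; apply: var_ideal_prime.
- move=> k kS; rewrite kS.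
  have [x xS xV]: exists2 x, x \in S & (x \notin V k) /\ x \in V k.+1.
    have /card_gt0P[x0 _] : (0 < #|S|)%N by apply: leq_trans kS.
    have kE : (k < size (enum S))%N by rewrite -cardE.
    have := mem_nth x0 kE; exists (nth x0 (enum S) k); first by rewrite -mem_enum.
    rewrite !inE (take_nth x0) // mem_rcons mem_head; split=> //.
    have := enum_uniq (mem S); rewrite -{1}(cat_take_drop k (enum S)) (drop_nth x0) //.
    by rewrite cat_uniq => /and3P[_ /hasPn/(_ _ (mem_head _ _))].
  have [xVk xVk1] := xV.
  case: ifP => _; split.
  + apply: var_ideal_le; first by have [] := var_ideal_prime (V k.+1).
    move=> i iV; apply/var_idealX; move: iV; rewrite !inE.
    by rewrite -addn1 takeD mem_cat => ->.
  + by move=> /(_ 'X_x) VV; move: xVk; rewrite (_ : x \in V k) //; apply/var_idealX/VV/var_idealX.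
  + by apply: var_ideal_le => // i /(subsetP (VS k)); apply: PX.
  + by move=> /(_ 'X_x) VV; move: xVk; rewrite (_ : x \in V k) //; apply/var_idealX/VV/PX.
- by rewrite ltnn.
Qed.

Lemma prime_chain_rcons (P P' : {mpoly K[n]} -> Prop) k :
    prime_chain P k -> prime_ideal P' -> ideal_le P P' -> ~ ideal_le P' P ->
  prime_chain P' k.+1.
Proof.
case=> Q [Qprime Qlt QP] P'prime PP' P'P.
exists (fun i => if (i <= k)%N then Q i else P'); split.
- by move=> i _; case: ifP => // ik; apply: Qprime.
- move=> i; rewrite ltnS => ik; rewrite ik; case: ifP => [ik'|]; first exact: Qlt.
  move/negbT; rewrite -leqNgt => ki; have -> : i = k by apply/eqP; rewrite eqn_leq ik.
  by split=> [a /QP/PP'|le]; last by apply: P'P => a /le/QP.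
- by rewrite ltnn.
Qed.

(** For the upper bound, a chain ending in the ideal of [S] is prolonged by the
    variables outside [S] to a chain of length at most [n]. *)
Lemma var_ideal_height S : prime_height (var_ideal S) #|S|.
Proof.
split; first by apply: var_chain (var_ideal_prime S) _ => i; rewrite var_idealX.
suff bound m k : prime_chain (var_ideal S) k -> #|~: S| = m -> (k + m <= n)%N.
  move=> k /bound/(_ erefl); have := cardsC S; rewrite card_ord; lia.
elim: m k S => [|m IH] k S0 chain cardS.
  by rewrite addn0; apply: prime_chain_le chain.
have /card_gt0P[x] : (0 < #|~: S0|)%N by rewrite cardS.
rewrite inE => xS0; rewrite addnS -addSn.
apply: (IH _ (x |: S0)); last first.
  by have := cardsD1 x (~: S0); rewrite inE xS0 cardS setCU setIC setDE => -[].
have [S0id _ _] := var_ideal_prime (x |: S0).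
apply: prime_chain_rcons chain (var_ideal_prime _) _ _.
  by apply: var_ideal_le => // i iS; apply/var_idealX; rewrite !inE iS orbT.
move=> /(_ 'X_x) le; move: xS0; rewrite (_ : x \in S0) //.
by apply/var_idealX/le/var_idealX/setU11.
Qed.

Variable E : {set {set 'I_n}}.

Lemma edge_idealP (P : {mpoly K[n]} -> Prop) :
  is_ideal P -> ideal_le (edge_ideal E) P <-> forall e, e \in E -> P (edge_monomial K e).
Proof.
move=> Pid; have [P0 PD PM] := Pid; split=> [EP e eE | PE p [c ->]].
  apply: EP; exists (fun f => if f == e then 1 else 0).
  rewrite (bigD1 e) //= eqxx mul1r big1 ?addr0 // => f /andP[_ /negbTE->].
  by rewrite mul0r.
by apply: ideal_sum => // e eE; apply/PM/PE.
Qed.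

Lemma edge_monomial_prime (P : {mpoly K[n]} -> Prop) e :
  prime_ideal P -> P (edge_monomial K e) <-> exists2 i, i \in e & P 'X_i.
Proof.
move=> Pp; have [[_ _ PM] _ _] := Pp; split; first exact: prime_prod.
by case=> i ie Pi; rewrite /edge_monomial (bigD1 i) //= mulrC; apply: PM.
Qed.

(** Primes containing the edge ideal contain all variables of some cover, and
    conversely the variables of a cover generate a prime containing it. *)
Lemma edge_ideal_height_cover g C :
    ideal_height (edge_ideal (K := K) E) g ->
    vertex_cover E C -> (forall D, vertex_cover E D -> (#|C| <= #|D|)%N) ->
  g = #|C|.
Proof.
case=> [[P [Pp EP [_ Pmax]]] gmin] Ccov Cmin; apply/eqP; rewrite eqn_leq.
have [Pid P1 _] := Pp; have Cp := var_ideal_prime C; have [Cid _ _] := Cp.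
apply/andP; split.
  apply: (gmin _ _ Cp _ (var_ideal_height C)); apply/(edge_idealP Cid) => e eE.
  apply/(edge_monomial_prime _ Cp); have /set0Pn[i] := forall_inP Ccov e eE.
  by rewrite inE => /andP[iC ie]; exists i => //; apply/var_idealX.
pose D := [set i : 'I_n | if excluded_middle_informative (P 'X_i) then true else false].
have DP i : i \in D <-> P 'X_i by rewrite inE; case: excluded_middle_informative.
apply: leq_trans (Cmin D _) (Pmax _ (var_chain Pp _)) => [|i /DP//].
apply/forall_inP => e eE; apply/set0Pn.
have [i ie Pi] := (edge_monomial_prime _ Pp).1 ((edge_idealP Pid).1 EP e eE).
by exists i; rewrite inE ie andbT; apply/DP.
Qed.

(** An empty edge would make the edge ideal the unit ideal, which no prime
    contains. *)
Lemma edge_ideal_height_set0 g : ideal_height (edge_ideal (K := K) E) g -> set0 \notin E.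
Proof.
case=> [[P [Pp EP _]] _]; apply/negP => E0; have [Pid _ _] := Pp.
have [i] := (edge_monomial_prime _ Pp).1 ((edge_idealP Pid).1 EP _ E0).
by rewrite inE.
Qed.

End Dimension.

(** * Doubly lexical orderings *)

Section LexicalOrder.
Variable W : finType.
Variable q : W -> nat.
Hypothesis q_inj : injective q.
Implicit Types (S : {set W}).

Lemma binary_lt S k : (forall w, w \in S -> q w < k) -> \sum_(w in S) 2 ^ q w < 2 ^ k.
Proof.
elim: k S => [|k IH] S qS.
  by rewrite big_pred0 // => w; apply/negP => /qS.
have Sk : \sum_(w in S | q w < k) 2 ^ q w < 2 ^ k.
  have := IH [set w in S | q w < k]; rewrite (eq_bigl (fun w => (w \in S) && (q w < k))).
    by apply=> w; rewrite inE => /andP[].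
  by move=> w; rewrite inE.
rewrite expnS mul2n -addnn (bigID (fun w => q w < k)) /= -addSn leq_add //.
have [w0 /andP[w0S qw0]|none] := pickP (fun w => (w \in S) && (q w == k)).
  rewrite (big_pred1 w0) => [|w]; first by rewrite (eqP qw0).
  rewrite -leqNgt /=; apply/andP/eqP => [[/qS wk kw]|->].
    by apply: q_inj; rewrite (eqP qw0); lia.
  by rewrite (eqP qw0).
rewrite big_pred0 // => w; apply/negP => /andP[wS]; rewrite -leqNgt => kw.
by have := none w; rewrite wS /=; have := qS w wS; lia.
Qed.

(** Sums of distinct powers of 2 are compared by their leading difference. *)
Lemma binary_le_lexical S S' w :
    \sum_(v in S) 2 ^ q v <= \sum_(v in S') 2 ^ q v -> w \in S :\: S' ->
  exists w', [/\ q w < q w', w' \in S' :\: S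
               & forall v, q w' < q v -> (v \in S) = (v \in S')].
Proof.
move=> leSS' wD; pose dif v := (v \in S) (+) (v \in S').
have dw : dif w by move: wD; rewrite inE /dif => /andP[/negbTE-> ->].
case: (arg_maxnP q dw) => w' dw' w'max.
have {}w'max v : dif v -> q v <= q w' by apply: w'max.
have agree v : q w' < q v -> (v \in S) = (v \in S').
  move=> lt_v; apply/eqP; rewrite -negb_add; apply/negP => /w'max.
  by rewrite leqNgt lt_v.
have [w'S|w'S] := boolP (w' \in S).
  have w'S' : w' \notin S' by move: dw'; rewrite /dif w'S.
  move: leSS'; rewrite leqNgt => /negP[].
  rewrite (big_setID S) [X in _ < X](big_setID S') /= setIC ltn_add2l.
  apply: (@leq_trans (2 ^ q w')).
    apply: binary_lt => v; rewrite inE => /andP[vS vS'].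
    rewrite ltn_neqAle w'max ?andbT; last by rewrite /dif vS' (negbTE vS).
    by apply: contraNneq vS => /q_inj->.
  by rewrite (bigD1 w') /= ?leq_addr // inE w'S'.
have w'S' : w' \in S' by move: dw'; rewrite /dif (negbTE w'S).
exists w'; split; rewrite ?inE ?w'S //.
rewrite ltn_neqAle (w'max w dw) andbT.
by apply: contraNneq w'S => /q_inj <-; move: wD; rewrite inE => /andP[].
Qed.

End LexicalOrder.

Section DoublyLexical.
Variables (U W : finType).

(** The rows of the matrix [A], read from the column with the largest [q] down,
    are weakly increasing along [p]; stated through the last column where two
    rows differ. *)
Definition lexical (A : U -> W -> bool) (p : U -> nat) (q : W -> nat) :=
  forall u u' w, p u < p u' -> A u w -> ~~ A u' w ->
  exists w', [/\ q w < q w', A u' w', ~~ A u w'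
               & forall v, q w' < q v -> A u v = A u' v].

Definition rank_of (T : finType) (s : {perm T}) (x : T) : nat := enum_rank (s x).

Lemma rank_of_inj (T : finType) (s : {perm T}) : injective (rank_of s).
Proof. by move=> x y /val_inj/enum_rank_inj/perm_inj. Qed.

(** A potential whose maximisers are doubly lexical: moving a
    lexicographically larger row to a later position increases it. *)
Definition weight (A : U -> W -> bool) (s : {perm U}) (t : {perm W}) :=
  \sum_u \sum_w A u w * 2 ^ (rank_of s u + rank_of t w).

Lemma max_weight_lexical A s t :
  (forall s', weight A s' t <= weight A s t) -> lexical A (rank_of s) (rank_of t).
Proof.
move=> smax u u' w lt_u Auw Au'w.
have uu' : u != u' by apply: contraTneq lt_u => ->; rewrite ltnn.
pose R v := \sum_(w in [set w | A v w]) 2 ^ rank_of t w.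
have wE s' : weight A s' t = \sum_v 2 ^ rank_of s' v * R v.
  apply: eq_bigr => v _; rewrite big_distrr /= [RHS]big_mkcond /=.
  by apply: eq_bigr => x _; rewrite inE expnD; case: (A v x); rewrite ?mul1n ?mul0n.
have Rle : R u <= R u'.
  (* Exchanging the positions of [u] and [u'] cannot increase the weight. *)
  have := smax (tperm u u' * s)%g; rewrite !wE.
  rewrite (bigD1 u) // (bigD1 u') 1?eq_sym //= [X in _ <= X](bigD1 u) //.
  rewrite [X in _ <= _ + X](bigD1 u') 1?eq_sym //= !addnA.
  rewrite (eq_bigr (fun v => 2 ^ rank_of s v * R v)); last first.
    by move=> v /andP[vu vu']; rewrite /rank_of permM tpermD // eq_sym.
  rewrite leq_add2r /rank_of !permM tpermL tpermR -!/(rank_of _ _).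
  have : 2 ^ rank_of s u < 2 ^ rank_of s u' by rewrite ltn_exp2l.
  nia.
have [|w' [lt_w w'D agree]] := binary_le_lexical (rank_of_inj (s := t)) Rle (w := w).
  by rewrite !inE Auw Au'w.
exists w'; move: w'D; rewrite !inE => /andP[Auw' Au'w']; split=> // v /agree.
by rewrite !inE.
Qed.

End DoublyLexical.

Lemma doubly_lexical (U W : finType) (A : U -> W -> bool) :
  exists (p : U -> nat) (q : W -> nat),
    [/\ injective p, injective q, lexical A p q & lexical (fun w u => A u w) q p].
Proof.
have [[s t] _ stmax] := arg_maxnP (fun st : {perm U} * {perm W} => weight A st.1 st.2)
  (erefl : predT (1%g, 1%g)).
exists (rank_of s), (rank_of t); split; try exact: rank_of_inj.
  by apply: max_weight_lexical => s'; apply: (stmax (s', t)).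
apply: max_weight_lexical => t'; have := stmax (s, t') isT.
rewrite /weight /= exchange_big [in X in _ <= X -> _]exchange_big /=.
by under eq_bigr => w _ do under eq_bigr => u _ do rewrite addnC;
   under [X in _ <= X -> _]eq_bigr => w _ do under eq_bigr => u _ do rewrite addnC.
Qed.

(** Adjacency of rows and columns along a cycle of length [k.+1]: a cycle read
    simultaneously in both directions from its incident pair (0, 0) ends in the
    incident pair (k, k), and in between row [a] meets columns [a-1] and [a+1]. *)
Definition folded k a b := [|| a.+1 == b, b.+1 == a | (a == b) && ((a == 0) || (a == k))].

Section GammaFree.
Variables (U W : finType) (A : U -> W -> bool).

Definition folded_cycle k (r : nat -> U) (c : nat -> W) :=
  forall a b, a <= k -> b <= k -> A (r a) (c b) = folded k a b.

(** From a forbidden 2 x 2 submatrix one walks away along ever later rows and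
    columns: as [c k] comes after [c k.-1] but row [r k] contains only the latter,
    a later row contains only the former; take the last such row as [r k.+1],
    and symmetrically for [c k.+1].  Taking the last differences guarantees that
    [r k.+1] avoids all columns before [c k].  If [r k.+1] and [c k.+1] were incident,
    a cycle would be closed; otherwise the walk never stops, which is impossible
    in a finite matrix. *)
Lemma lexical_gamma_free p q :
    lexical A p q -> lexical (fun w u => A u w) q p ->
    (forall k r c, 2 <= k -> ~ folded_cycle k r c) ->
  forall x x' e e', p x < p x' -> q e < q e' -> A x e -> A x e' -> A x' e -> A x' e'.
Proof.
move=> lexA lexAT nocycle x x' e e' ltx lte xe xe' x'e; apply/negPn/negP => x'e'.
pose walk k (r : nat -> U) (c : nat -> W) :=
  [/\ forall a b, a <= k.+1 -> b <= k.+1 ->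
        A (r a) (c b) = [|| a.+1 == b, b.+1 == a | (a == 0) && (b == 0)],
      forall a b, a < b <= k.+1 -> p (r a) < p (r b) /\ q (c a) < q (c b),
      forall a u, a < k -> p (r k.+1) < p u -> A u (c a) = A u (c a.+1)
    & forall b w, b < k -> q (c k.+1) < q w -> A (r b) w = A (r b.+1) w].
have walks k : exists r c, walk k r c.
  elim: k => [|k [r [c [rc inc agr agc]]]].
    exists (fun a => if a == 0 then x else x'), (fun b => if b == 0 then e else e').
    split=> //; first by case=> [|[|a]] [|[|b]] //= _ _; apply/negbTE.
    by case=> [|a] [|[|b]] //= /andP[].
  have [pk qk] : p (r k) < p (r k.+1) /\ q (c k) < q (c k.+1) by apply: inc; lia.
  have [u [lt_u uk1 uk agu]] : exists u, [/\ p (r k.+1) < p u, A u (c k.+1), ~~ A u (c k)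
      & forall v, p u < p v -> A v (c k) = A v (c k.+1)].
    by apply: lexAT qk _ _; rewrite rc //; lia.
  have [w [lt_w wk1 wk agw]] : exists w, [/\ q (c k.+1) < q w, A (r k.+1) w, ~~ A (r k) w
      & forall v, q w < q v -> A (r k) v = A (r k.+1) v].
    by apply: lexA pk _ _; rewrite rc //; lia.
  have uc b : b <= k -> A u (c b) = false.
    move=> bk; rewrite -(subKn bk); elim: (k - b) (leq_subr b k) => [|d IH] dk.
      by rewrite subn0; apply/negbTE.
    have dk' : k - d.+1 < k by move: dk; clear; lia.
    by rewrite agr // subnSK // IH // ltnW.
  have rw a : a <= k -> A (r a) w = false.
    move=> ak; rewrite -(subKn ak); elim: (k - a) (leq_subr a k) => [|d IH] dk.
      by rewrite subn0; apply/negbTE.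
    have dk' : k - d.+1 < k by move: dk; clear; lia.
    by rewrite agc // subnSK // IH // ltnW.
  pose r' a := if a == k.+2 then u else r a; pose c' b := if b == k.+2 then w else c b.
  have r'E a : a <= k.+1 -> r' a = r a by move=> ak; rewrite /r' ltn_eqF.
  have c'E b : b <= k.+1 -> c' b = c b by move=> bk; rewrite /c' ltn_eqF.
  have r'k : r' k.+2 = u by rewrite /r' eqxx.
  have c'k : c' k.+2 = w by rewrite /c' eqxx.
  (* [z] tells whether the walk closes up into a cycle at this stage. *)
  have adj (z : bool) : A u w = z -> forall a b, a <= k.+2 -> b <= k.+2 ->
      A (r' a) (c' b) = [|| a.+1 == b, b.+1 == a | (a == b) && ((a == 0) || ((a == k.+2) && z))].
    move=> uw a b; rewrite leq_eqVlt => /orP[/eqP->|ak]; rewrite leq_eqVlt => /orP[/eqP->|bk].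
    - by rewrite r'k c'k uw; clear; lia.
    - rewrite r'k c'E //; have [->|bk'] := eqVneq b k.+1; first by rewrite uk1; clear; lia.
      by rewrite uc; move: bk bk'; clear; lia.
    - rewrite c'k r'E //; have [->|ak'] := eqVneq a k.+1; first by rewrite wk1; clear; lia.
      by rewrite rw; move: ak ak'; clear; lia.
    - by rewrite r'E // c'E // rc //; move: ak bk; clear; lia.
  case uw: (A u w).
    case: (nocycle k.+2 r' c') => // a b ak bk.
    by rewrite (adj _ uw) // /folded andbT.
  exists r', c'; split.
  - by move=> a b ak bk; rewrite (adj _ uw) //; move: ak bk; clear; lia.
  - move=> a b /andP[ab]; rewrite leq_eqVlt => /orP[/eqP bk|bk].
      have ak : a <= k.+1 by move: ab; rewrite bk.
      rewrite bk r'k c'k r'E // c'E //; have [->//|ak'] := eqVneq a k.+1.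
      have [|pa qa] := inc a k.+1; first by rewrite leqnn andbT ltn_neqAle ak'.
      by rewrite (ltn_trans pa) ?(ltn_trans qa).
    have ak : a <= k.+1 by exact: ltnW (leq_trans ab bk).
    by rewrite !r'E // !c'E //; apply: inc; rewrite ab.
  - move=> a v ak uv; have ak1 := leqW ak.
    rewrite r'k in uv; rewrite !c'E //.
    have [->|ak'] := eqVneq a k; first exact: agu.
    by apply: agr (ltn_trans lt_u uv); rewrite ltn_neqAle ak'.
  - move=> b v bk wv; have bk1 := leqW bk.
    rewrite c'k in wv; rewrite !r'E //.
    have [->|bk'] := eqVneq b k; first exact: agw.
    by apply: agc (ltn_trans lt_w wv); rewrite ltn_neqAle bk'.
have [r [c [_ inc _ _]]] := walks #|U|.
suff /leq_card : injective (fun a : 'I_#|U|.+1 => r a) by rewrite card_ord ltnn.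
have lt_r (a b : 'I_#|U|.+1) : a < b -> r a <> r b.
  move=> ab rab; have [] := inc a b; first by rewrite ab -ltnS ltnS ltnW.
  by rewrite rab ltnn.
move=> a b rab; have [/lt_r/(_ rab)//|/lt_r/(_ (esym rab))//|] := ltngtP a b.
exact: val_inj.
Qed.

End GammaFree.

Section TotallyBalanced.
Variables (n : nat) (E : {set {set 'I_n}}).
Hypothesis hbalanced : totally_balanced E.

(** For [2 <= k] each row and each column of the pattern has two ones, and
    distinct rows, as well as distinct columns, differ; hence the injectivity
    required of a cycle. *)
Lemma no_folded_cycle k (r : nat -> 'I_n) (c : nat -> {set 'I_n}) :
    2 <= k -> (forall b, b <= k -> c b \in E) ->
  ~ folded_cycle (fun x (e : {set 'I_n}) => x \in e) k r c.
Proof.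
move=> k2 cE rc.
have foldedC a b : folded k a b = folded k b a.
  by rewrite /folded; clear; apply/idP/idP; lia.
have folded_inj a a' : a <= k -> a' <= k ->
    (forall b, b <= k -> folded k a b = folded k a' b) -> a = a'.
  wlog lt : a a' / a < a' => [hw ak ak' eq|].
    have [|/hw|//] := ltngtP a a'; first by move=> /hw; apply.
    by move=> h; apply/esym/h => // b bk; rewrite eq.
  case: a lt => [|a] lt _ ak' eq; last first.
    by have := eq a (leq_trans (ltnW (ltnW lt)) ak'); rewrite /folded; move: lt; clear; lia.
  have := eq 0 (leq0n k); have := eq 1 (ltnW k2); rewrite /folded; move: lt k2; clear; lia.
have card2 a : a <= k -> #|[set b : 'I_k.+1 | folded k a b]| = 2.
  move=> ak; have h1 : a.-1 < k.+1 by move: ak; clear; lia.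
  have h2 : (if a == k then k else a.+1) < k.+1 by move: ak; clear; case: eqP; lia.
  rewrite (_ : [set _ | _] = [set Ordinal h1; Ordinal h2]).
    rewrite cards2 (_ : (_ == _) = false) //; apply/negbTE; rewrite -val_eqE /=.
    by move: ak k2; clear; case: (a =P k); lia.
  apply/setP => b; rewrite !inE -!val_eqE /= /folded; have := ltn_ord b.
  by move: ak k2; clear; case: (a =P k); lia.
have ord_le (a : 'I_k.+1) : a <= k by rewrite -ltnS.
have cEi (b : 'I_k.+1) : c b \in E := cE b (ord_le b).
have inc (a b : 'I_k.+1) : (r a \in c b) = folded k a b := rc a b (ord_le a) (ord_le b).
pose cols (b : 'I_k.+1) := enum_rank_in (cEi b) (c b).
apply: (hbalanced (r := k.+1)); split=> //; exists (fun a : 'I_k.+1 => r a), cols; split.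
- move=> a a' eq; apply/val_inj/(folded_inj _ _ (ord_le a) (ord_le a')) => b bk.
  by have := inc a (Ordinal (bk : b < k.+1)); rewrite eq inc.
- move=> b b' /(congr1 enum_val); rewrite /cols !enum_rankK_in ?cEi // => eq.
  apply/val_inj/(folded_inj _ _ (ord_le b) (ord_le b')) => a ak; rewrite ![folded k _ a]foldedC.
  by have := inc (Ordinal (ak : a < k.+1)) b; rewrite eq inc.
split=> [a|b].
  apply: etrans (card2 a (ord_le a)); apply: eq_card => b.
  by rewrite !inE !mxE /cols enum_rankK_in ?cEi // inc eqb1.
apply: etrans (card2 b (ord_le b)); apply: eq_card => a.
by rewrite !inE !mxE /cols enum_rankK_in ?cEi // inc eqb1 foldedC.
Qed.

Lemma no_3cycle x y z e f h : e \in E -> f \in E -> h \in E ->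
    x \in e -> y \in e -> z \notin e -> y \in f -> z \in f -> x \notin f ->
    z \in h -> x \in h -> y \notin h -> False.
Proof.
move=> eE fE hE xe ye ze yf zf xf zh xh yh.
apply: (@no_folded_cycle 2 (nth x [:: x; y; z]) (nth set0 [:: e; h; f])) => //.
  by case=> [|[|[|]]].
by case=> [|[|[|a]]] // [|[|[|b]]] //=; rewrite ?(negbTE ze) ?(negbTE xf) ?(negbTE yh).
Qed.

Lemma no_4cycle x y z t e f h k : e \in E -> f \in E -> h \in E -> k \in E ->
    x \in e -> y \in e -> z \notin e -> t \notin e ->
    y \in f -> z \in f -> x \notin f -> t \notin f ->
    z \in h -> t \in h -> x \notin h -> y \notin h ->
    t \in k -> x \in k -> y \notin k -> z \notin k -> False.
Proof.
move=> eE fE hE kE xe ye ze te yf zf xf tf zh th xh yh tk xk yk zk.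
apply: (@no_folded_cycle 3 (nth x [:: x; y; t; z]) (nth set0 [:: e; k; f; h])) => //.
  by case=> [|[|[|[|]]]].
by case=> [|[|[|[|a]]]] // [|[|[|[|b]]]] //=; rewrite ?(negbTE ze) ?(negbTE te)
  ?(negbTE xf) ?(negbTE tf) ?(negbTE xh) ?(negbTE yh) ?(negbTE yk) ?(negbTE zk).
Qed.

(** The incidence relation is extended to all vertex sets by giving the sets
    outside [E] empty columns, which occur in no cycle. *)
Lemma gamma_free_order :
  exists (p : 'I_n -> nat) (q : {set 'I_n} -> nat), [/\ injective p, injective q
    & forall x x' e e', e \in E -> e' \in E -> p x < p x' -> q e < q e' ->
        x \in e -> x \in e' -> x' \in e -> x' \in e'].
Proof.
pose A (x : 'I_n) (e : {set 'I_n}) := (e \in E) && (x \in e).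
have [p [q [pinj qinj lexA lexAT]]] := doubly_lexical A.
exists p, q; split=> // x x' e e' eE e'E ltx lte xe xe' x'e.
have nocycle k r c : 2 <= k -> ~ folded_cycle A k r c.
  move=> k2 rc; apply: (@no_folded_cycle k r c) => // [b bk|a b ak bk].
    have : exists2 a, a <= k & folded k a b.
      by exists b.-1; rewrite /folded; lia.
    by case=> a ak; rewrite -(rc a b ak bk) => /andP[].
  rewrite -(rc a b ak bk) /A; suff -> : c b \in E by [].
  have : exists2 a, a <= k & folded k a b by exists b.-1; rewrite /folded; lia.
  by case=> a' ak'; rewrite -(rc a' b ak' bk) => /andP[].
have := lexical_gamma_free lexA lexAT nocycle ltx lte.
by rewrite /A eE e'E xe xe' x'e => /(_ isT isT isT).
Qed.

End TotallyBalanced.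

(** * Matchings and covers of unmixed clutters *)

Section Konig.
Variables (T : finType).
Implicit Types (E M : {set {set T}}) (C D S e f : {set T}).

Lemma vertex_cover_minset E S :
  vertex_cover E S -> exists2 C, minset (vertex_cover E) C & C \subset S.
Proof. by case/minset_exists=> C; exists C. Qed.

(** Pick the first edge [e]; its last vertex [v] lies on every edge meeting [e],
    so [v] covers all edges that can no longer be picked. *)
Lemma greedy_matching E (p : T -> nat) (q : {set T} -> nat) :
    injective p -> injective q ->
    (forall x x' e e', e \in E -> e' \in E -> p x < p x' -> q e < q e' ->
       x \in e -> x \in e' -> x' \in e -> x' \in e') ->
    set0 \notin E ->
  exists M C, [/\ M \subset E, trivIset M, vertex_cover E C & #|C| <= #|M|].
Proof.
move=> pinj qinj; have [m] := ubnP #|E|; elim: m E => // m IH E cardE gamma E0.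
have [->|/set0Pn[e1 e1E]] := eqVneq E set0.
  exists set0, set0; rewrite sub0set cards0; split=> //.
    by apply/trivIsetP => A B; rewrite inE.
  by apply/forall_inP => e; rewrite inE.
have [e eE emin] := arg_minnP q e1E; have {}eE : e \in E by [].
have {}emin f : f \in E -> q e <= q f by apply: emin.
have /set0Pn[v1 v1e] : e != set0 by apply: contraNneq E0 => <-.
have [v ve vmax] := arg_maxnP p v1e; have {}ve : v \in e by [].
have {}vmax x : x \in e -> p x <= p v by apply: vmax.
have v_meets f : f \in E -> ~~ [disjoint e & f] -> v \in f.
  move=> fE; rewrite -setI_eq0 => /set0Pn[x]; rewrite inE => /andP[xe xf].
  have [<-//|fe] := eqVneq e f; have [<-//|xv] := eqVneq x v.
  apply: (gamma x v e f) => //; rewrite ltn_neqAle.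
    by rewrite vmax // (inj_eq pinj) xv.
  by rewrite emin // (inj_eq qinj) fe.
pose E' := [set f in E | [disjoint e & f]].
have E'E : E' \subset E by apply/subsetP => f; rewrite inE => /andP[].
have [|||M [C [ME' trivM Ccov CM]]] := IH E'.
- rewrite -ltnS; apply: leq_trans cardE; rewrite ltnS; apply/proper_card/properP; split=> //.
  by exists e => //; rewrite inE eE /= -setI_eq0 setIid; apply/set0Pn; exists v.
- by move=> x x' f f' /(subsetP E'E) fE /(subsetP E'E) f'E; apply: gamma.
- by apply: contra E0; apply: (subsetP E'E).
have disjM : {in M, forall f, [disjoint e & f]}.
  by move=> f /(subsetP ME'); rewrite inE => /andP[].
have M0 : set0 \notin M by apply: contra E0 => /(subsetP ME')/(subsetP E'E).
have [trivM' eM] := trivIsetU1 disjM trivM M0.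
exists (e |: M), (v |: C); split=> //.
- by rewrite subUset sub1set eE (subset_trans ME').
- apply/forall_inP => f fE; apply/set0Pn.
  have [ef|/(v_meets f fE) vf] := boolP [disjoint e & f]; last first.
    by exists v; rewrite !inE eqxx.
  have /set0Pn[x] : C :&: f != set0 by apply: (forall_inP Ccov); rewrite inE fE.
  by rewrite inE => /andP[xC xf]; exists x; rewrite !inE xC orbT.
- by rewrite !cardsU1 eM; apply: leq_add => //; case: (v \notin C).
Qed.

Section Matching.
Variables E M : {set {set T}}.
Hypotheses (ME : M \subset E) (trivM : trivIset M).

Lemma matching_cap_cover C : \sum_(e in M) #|C :&: e| = #|C :&: cover M|.
Proof.
rewrite -sum1_card (eq_bigl (fun x => (x \in cover M) && (x \in C))); last first.
  by move=> x; rewrite inE andbC.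
rewrite (big_trivIset_cond _ trivM); apply: eq_bigr => e _.
by rewrite -sum1_card; apply: eq_bigl => x; rewrite inE andbC.
Qed.

Lemma cover_meets C : vertex_cover E C -> forall e, e \in M -> 0 < #|C :&: e|.
Proof. by move=> /forall_inP Ccov e /(subsetP ME)/Ccov; rewrite card_gt0. Qed.

Lemma matching_leq_cover C : vertex_cover E C -> #|M| <= #|C|.
Proof.
move=> Ccov; apply: leq_trans (subset_leq_card (subsetIl C (cover M))).
by rewrite -matching_cap_cover -sum1_card; apply: leq_sum => e /(cover_meets Ccov).
Qed.

(** A cover has a vertex on each of the disjoint edges of [M], so a cover of
    size [#|M|] has no room for anything else. *)
Lemma tight_cover C : vertex_cover E C -> #|C| = #|M| ->
  C \subset cover M /\ forall e, e \in M -> #|C :&: e| = 1.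
Proof.
move=> Ccov CM.
have le1 e : e \in M -> 1 <= #|C :&: e| ?= iff (#|C :&: e| == 1).
  by move=> eM; split; [apply: cover_meets|rewrite eq_sym].
have [leM eqM] := leqif_sum le1.
have leC := subset_leq_card (subsetIl C (cover M)).
have capC : #|C :&: cover M| = #|C|.
  by apply/eqP; rewrite eqn_leq leC CM -sum1_card -matching_cap_cover.
split; first by apply/setIidPl/eqP; rewrite eqEcard subsetIl capC leqnn.
move: eqM; rewrite sum1_card matching_cap_cover capC CM eqxx => /esym/forall_inP eqM.
by move=> e /eqM/eqP.
Qed.

End Matching.

End Konig.

Section UnmixedMatching.
Variables (T : finType) (E M : {set {set T}}).
Hypothesis hclutter : is_clutter E.
Hypotheses (ME : M \subset E) (trivM : trivIset M).
Hypothesis cover_card : forall C, minset (vertex_cover E) C -> #|C| = #|M|.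
Implicit Types (C D S e f : {set T}).

Lemma independent_cover S : independent E S = vertex_cover E (~: S).
Proof.
by apply: eq_forallb => e; rewrite subsets_disjoint -setI_eq0 setIC.
Qed.

Lemma minimal_cover_trace C : minset (vertex_cover E) C ->
  C \subset cover M /\ forall e, e \in M -> #|C :&: e| = 1.
Proof.
move=> Cmin; have [Ccov _] := minsetP Cmin.
exact: (tight_cover ME trivM Ccov (cover_card Cmin)).
Qed.

(** No edge fits into [e :\ x] when [x] is a vertex of the edge [e], so the
    complement of [e :\ x] contains a minimal cover; it meets [e] in [x] only,
    and lies in [cover M]. *)
Lemma perfect_matching : (forall x, ~~ isolated_vertex E x) -> cover M = setT.
Proof.
move=> hisolated; apply/setP => x; rewrite inE.
have [e eE xe] : exists2 e, e \in E & x \in e.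
  have := hisolated x; rewrite negb_forall_in => /exists_inP[e eE].
  by rewrite negbK; exists e.
have ind : independent E (e :\ x).
  apply/forall_inP => f fE; apply/negP => fe.
  have fe' := hclutter fE eE (subset_trans fe (subsetDl _ _)).
  by move/subsetP/(_ x): fe; rewrite fe' !inE eqxx xe => /(_ isT).
move: ind; rewrite independent_cover => /vertex_cover_minset[C Cmin CS].
have [/subsetP CM _] := minimal_cover_trace Cmin; apply: CM.
have [Ccov _] := minsetP Cmin; have /set0Pn[y] := forall_inP Ccov e eE.
rewrite inE => /andP[yC ye]; have := subsetP CS y yC.
by rewrite !inE ye andbT negbK => /eqP <-.
Qed.

(** Otherwise some minimal cover avoids [(f :\ x) :|: (f' :\ y)], hence contains
    both [x] and [y], two vertices of the same edge of [M]. *)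
Lemma matching_exchange e f f' x y :
    e \in M -> f \in E -> f' \in E -> x \in e -> y \in e -> x != y ->
    x \in f -> y \in f' ->
  exists2 h, h \in E & h \subset (f :\ x) :|: (f' :\ y).
Proof.
move=> eM fE f'E xe ye xy xf yf'; apply/exists_inP; apply: contraT; rewrite negb_exists_in.
rewrite -[X in is_true X]/(independent E _) independent_cover => /vertex_cover_minset[C Cmin CS].
have [Ccov _] := minsetP Cmin.
have only g z : g \in E -> g :\ z \subset (f :\ x) :|: (f' :\ y) -> z \in g -> z \in C.
  move=> gE gS zg; have /set0Pn[w] := forall_inP Ccov g gE.
  rewrite inE => /andP[wC wg]; have [<-//|wz] := eqVneq w z.
  by have := subsetP CS w wC; rewrite inE (subsetP gS) // !inE wz.
have xC : x \in C by apply: (only f); rewrite ?subsetUl.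
have yC : y \in C by apply: (only f'); rewrite ?subsetUr.
have [_ /(_ e eM) /eqP] := minimal_cover_trace Cmin.
case/cards1P => z Cz; have : x \in [set z] by rewrite -Cz inE xC.
have : y \in [set z] by rewrite -Cz inE yC.
by rewrite !inE => /eqP yz /eqP xz; rewrite xz yz eqxx in xy.
Qed.

End UnmixedMatching.

(** * Traces on the matching, free vertices and shelling *)

Section NestedTraces.
Variables (n : nat) (E M : {set {set 'I_n}}).
Hypothesis hclutter : is_clutter E.
Hypothesis hbalanced : totally_balanced E.
Hypotheses (ME : M \subset E) (trivM : trivIset M).
Hypothesis cover_card : forall C, minset (vertex_cover E) C -> #|C| = #|M|.
Implicit Types (C D S e f : {set 'I_n}).

(** The edge [h] obtained by exchange avoids [x] and [y], and has vertices [u]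
    of [f' :\: f] and [v] of [f :\: f'].  When [u] and [v] are both outside [e],
    the edges [e, f', h, f] form a 4-cycle on [x, y, u, v]; when exactly one of
    them is in [e], there is a 3-cycle.  When both are in [e], some vertex
    [w] of [h] outside [e] lies on [f] or [f'], and again there is a 3-cycle. *)
Lemma nested_traces e f f' x y :
    e \in M -> f \in E -> f' \in E -> x \in e -> y \in e ->
    x \in f -> x \notin f' -> y \in f' -> y \notin f -> False.
Proof.
move=> eM fE f'E xe ye xf xf' yf' yf; have eE := subsetP ME e eM.
have xy : x != y by apply: contraNneq yf => <-.
have [h hE hS] := matching_exchange ME trivM cover_card eM fE f'E xe ye xy xf yf'.
have inh z : z \in h -> (z != x) && (z \in f) || (z != y) && (z \in f').
  by move=> /(subsetP hS); rewrite !inE.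
have xh : x \notin h by apply/negP => /inh; rewrite eqxx (negbTE xf') andbF.
have yh : y \notin h by apply/negP => /inh; rewrite eqxx (negbTE yf) andbF.
have notsub g : g \in E -> (exists2 z, z \in g & z \notin h) ->
    exists2 z, z \in h & z \notin g.
  move=> gE [z zg zh]; apply/subsetPn; apply/negP => hg.
  by move: zh; rewrite (hclutter hE gE hg) zg.
have [u uh uf] : exists2 u, u \in h & u \notin f by apply: notsub fE _; exists x.
have [v vh vf'] : exists2 v, v \in h & v \notin f' by apply: notsub f'E _; exists y.
have [w wh we] : exists2 w, w \in h & w \notin e by apply: notsub eE _; exists x.
have uf' : u \in f' by have := inh u uh; rewrite (negbTE uf) andbF => /andP[].
have vf : v \in f by have := inh v vh; rewrite (negbTE vf') andbF orbF => /andP[].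
have [ue|ue] := boolP (u \in e); have [ve|ve] := boolP (v \in e).
- have [wf|wf] := boolP (w \in f); have [wf'|wf'] := boolP (w \in f').
  + exact: (@no_3cycle n E hbalanced x y w e f' f).
  + exact: (@no_3cycle n E hbalanced x u w e h f).
  + exact: (@no_3cycle n E hbalanced y v w e h f').
  + by have := inh w wh; rewrite (negbTE wf) (negbTE wf') !andbF.
- exact: (@no_3cycle n E hbalanced x u v e h f).
- exact: (@no_3cycle n E hbalanced y v u e h f').
- exact: (@no_4cycle n E hbalanced x y u v e f' h f).
Qed.

(** If no vertex of [e] is free, let [f] have the largest trace on [e] among
    the other edges, and let [f'] be another edge through a vertex of [e] missed
    by [f]: by the choice of [f], the two traces are not nested. *)
Lemma matching_free_vertex e :
    set0 \notin E -> e \in M ->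
  exists2 x, x \in e & free_vertex E x.
Proof.
move=> E0 eM; have eE := subsetP ME e eM.
apply/exists_inP; apply: contraT; rewrite negb_exists_in => /forall_inP nofree.
have other x : x \in e -> exists2 f, f \in E & (f != e) && (x \in f).
  move=> xe; apply/exists_inP; apply: contraT; rewrite negb_exists_in => /forall_inP none.
  have := nofree x xe; rewrite /free_vertex (_ : [set _ in _ | _] = [set e]) ?cards1 //.
  apply/setP => f; rewrite !inE; apply/andP/eqP => [[fE xf]|->//].
  by apply/eqP; have := none f fE; rewrite xf andbT negbK.
have /set0Pn[x0 x0e] : e != set0 by apply: contraNneq E0 => <-.
have [f0 f0E /andP[f0e _]] := other x0 x0e.
have f0P : (f0 \in E) && (f0 != e) by rewrite f0E.
have [f /andP[fE fe] fmax] :=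
  @arg_maxnP _ f0 (fun f => (f \in E) && (f != e)) (fun f => #|f :&: e|) f0P.
have [y ye yf] : exists2 y, y \in e & y \notin f.
  by apply/subsetPn; apply: contra fe => ef; rewrite (hclutter eE fE ef).
have [f' f'E /andP[f'e yf']] := other y ye.
have [x xe /andP[xf xf']] : exists2 x, x \in e & (x \in f) && (x \notin f').
  apply/exists_inP; apply: contraT; rewrite negb_exists_in => /forall_inP sub.
  suff : #|f :&: e| < #|f' :&: e|.
    by rewrite ltnNge => /negP[]; apply: (fmax f'); rewrite f'E.
  apply/proper_card/properP; split; last first.
    by exists y; rewrite !inE ?yf' ?ye // (negbTE yf).
  apply/subsetP => z; rewrite !inE => /andP[zf ze]; rewrite ze andbT.
  by have := sub z ze; rewrite zf negbK.
by case: (@nested_traces e f f' x y).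
Qed.

Definition degree (x : 'I_n) := #|[set f in E | x \in f]|.

(** On an edge of the matching the sets of edges through two vertices are
    nested, so they are compared by their cardinalities. *)
Lemma trace_degree e f x y : e \in M -> f \in E -> x \in e -> y \in e ->
  degree x <= degree y -> x \in f -> y \in f.
Proof.
move=> eM fE xe ye; rewrite leqNgt => deg xf; apply: contraR deg => yf.
apply/proper_card/properP; split; last first.
  by exists f; rewrite !inE ?fE // (negbTE yf).
apply/subsetP => f'; rewrite !inE => /andP[f'E yf']; rewrite f'E /=.
by apply: contraT => xf'; case: (@nested_traces e f f' x y).
Qed.

(** Vertices of large degree come first, and the index breaks ties. *)
Definition rank (x : 'I_n) := (#|E| - degree x) * n + x.

Lemma rank_inj : injective rank.
Proof.
move=> x y /(congr1 (modn^~ n)); rewrite /rank !modnMDl !modn_small ?ltn_ord //.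
exact: val_inj.
Qed.

Lemma rank_lt_degree x y : rank x < rank y -> degree y <= degree x.
Proof.
have degE z : degree z <= #|E| by apply/subset_leq_card/subsetP => f; rewrite inE => /andP[].
have := degE x; have := degE y; have := ltn_ord x; have := ltn_ord y; rewrite /rank.
move: (degree x) (degree y) #|E| (x : nat) (y : nat) => dx dy d i j jn in_ dyd dxd.
rewrite [_ <= dx]leqNgt => lt; apply/negP => dxy; move: lt; rewrite ltnNge => /negP[].
have -> : d - dx = (d - dy) + (dy - dx) by lia.
have ge_n : n <= (dy - dx) * n by rewrite leq_pmull // subn_gt0.
by rewrite mulnDl -addnA leq_add2l (leq_trans (ltnW jn)) // (leq_trans ge_n) ?leq_addr.
Qed.

Definition cover_rank C := \sum_(x in C) rank x.

(** As the rank of [D] is not smaller and all covers have one vertex on each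
    edge of [M], some edge of [M] meets [C] in [x] and [D] in [y] with [x] of
    smaller rank.  Then every edge through [y] contains [x], and [D'] is [D] with
    [y] replaced by [x]. *)
Lemma cover_exchange C D :
    minset (vertex_cover E) C -> minset (vertex_cover E) D -> C != D ->
    cover_rank C <= cover_rank D ->
  exists x D', [/\ minset (vertex_cover E) D', cover_rank D' < cover_rank D,
                   x \in C :\: D & D' :\: D = [set x]].
Proof.
move=> Cmin Dmin CD leCD.
have traceM A : minset (vertex_cover E) A -> forall e, e \in M -> exists x, A :&: e = [set x].
  move=> Amin e eM; have [_ /(_ e eM)/eqP/cards1P] := minimal_cover_trace ME trivM cover_card Amin.
  by [].
have rankM A : minset (vertex_cover E) A ->
    cover_rank A = \sum_(e in M) \sum_(x in A :&: e) rank x.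
  move=> Amin; have [/setIidPr <- _] := minimal_cover_trace ME trivM cover_card Amin.
  rewrite /cover_rank (eq_bigl (fun x => (x \in cover M) && (x \in A))); last first.
    by move=> x; rewrite inE.
  rewrite (big_trivIset_cond _ trivM); apply: eq_bigr => e eM; apply: eq_bigl => x.
  have xcov : x \in e -> x \in cover M by move=> xe; apply/bigcupP; exists e.
  by rewrite !inE; case: (x \in e) xcov => [->|]; rewrite ?andbT ?andbF.
have [e eM ltCD] : exists2 e, e \in M &
    \sum_(x in C :&: e) rank x < \sum_(x in D :&: e) rank x.
  apply/exists_inP; apply: contraT; rewrite negb_exists_in => /forall_inP ge.
  have leif e : e \in M -> \sum_(x in D :&: e) rank x <= \sum_(x in C :&: e) rank x
      ?= iff (\sum_(x in D :&: e) rank x == \sum_(x in C :&: e) rank x).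
    by move=> eM; split=> //; rewrite leqNgt ge.
  have [leDC] := leqif_sum leif; rewrite -!rankM // in leDC *.
  rewrite eqn_leq leCD leDC => /esym/forall_inP eqe.
  case/eqP: CD; have [CM _] := minimal_cover_trace ME trivM cover_card Cmin.
  have [DM _] := minimal_cover_trace ME trivM cover_card Dmin.
  have same e : e \in M -> C :&: e = D :&: e.
    move=> eM; have [x Cx] := traceM _ Cmin e eM; have [y Dy] := traceM _ Dmin e eM.
    by have := eqe e eM; rewrite Cx Dy !big_set1 => /eqP/rank_inj->.
  have sub (A B : {set 'I_n}) :
      A \subset cover M -> (forall e, e \in M -> A :&: e = B :&: e) -> A \subset B.
    move=> AM AB; apply/subsetP => x xA; have /bigcupP[e eM xe] := subsetP AM x xA.
    have : x \in A :&: e by rewrite inE xA.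
    by rewrite AB // => /setIP[].
  by apply/eqP; rewrite eqEsubset; apply/andP; split; apply: sub => // e' /same.
have [x Cx] := traceM _ Cmin e eM; have [y Dy] := traceM _ Dmin e eM.
move: ltCD; rewrite Cx Dy !big_set1 => ltxy.
have [xC xe] : x \in C /\ x \in e by apply/setIP; rewrite Cx set11.
have [yD ye] : y \in D /\ y \in e by apply/setIP; rewrite Dy set11.
have xy : x != y by apply: contraTneq ltxy => ->; rewrite ltnn.
have xD : x \notin D.
  by apply: contra xy => xD; rewrite -in_set1 -Dy inE xD.
have [Dcov _] := minsetP Dmin.
have D'cov : vertex_cover E (x |: (D :\ y)).
  apply/forall_inP => f fE; apply/set0Pn.
  have /set0Pn[z] := forall_inP Dcov f fE; rewrite inE => /andP[zD zf].
  have [zy|zy] := eqVneq z y; last by exists z; rewrite !inE zy zD zf orbT.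
  exists x; rewrite !inE eqxx /=.
  by apply: (trace_degree eM fE ye xe (rank_lt_degree ltxy)); rewrite -zy.
have cardD' : #|x |: (D :\ y)| = #|M|.
  by rewrite cardsU1 !inE (negbTE xD) andbF -(cover_card Dmin) (cardsD1 y D) yD.
exists x, (x |: (D :\ y)); split.
- apply/minsetP; split=> // B Bcov BD'; apply/eqP; rewrite eqEcard BD' cardD'.
  exact: (matching_leq_cover ME trivM Bcov).
- rewrite /cover_rank big_setU1 /= ?(big_setD1 y yD) ?ltn_add2r //.
  by rewrite !inE (negbTE xD) andbF.
- by rewrite inE xD.
- apply/setP => z; rewrite !inE; have [->|_] := eqVneq z x; first by rewrite xD.
  by case: (z \in D); rewrite ?andbF.
Qed.

Lemma facets_independence_complex F :
  (F \in facets (independence_complex E)) = minset (vertex_cover E) (~: F).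
Proof.
rewrite inE maxminset; apply: minset_eq => B.
by rewrite /= inE independent_cover setCK.
Qed.

(** Facets are listed by increasing rank of the complementary covers; the
    condition on shellings is then the exchange property. *)
Lemma independence_complex_shellable : shellable (independence_complex E).
Proof.
pose D := facets (independence_complex E).
pose le (F F' : {set 'I_n}) := cover_rank (~: F) <= cover_rank (~: F').
have le_tr : transitive le by move=> ? ? ?; apply: leq_trans.
have le_refl : reflexive le by move=> ?; apply: leqnn.
have le_tot : total le by move=> ? ?; apply: leq_total.
pose s := sort le (enum D).
have sD : s =i D by move=> F; rewrite mem_sort mem_enum.
have suniq : uniq s by rewrite sort_uniq enum_uniq.
have sle i j : i <= j -> i < size s -> j < size s -> le (nth set0 s i) (nth set0 s j).
  move=> ij si sj; apply: (sorted_leq_nth le_tr le_refl) => //; exact: sort_sorted.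
exists s; split=> // i j /andP[ij js]; have si := ltn_trans ij js.
have min k : k < size s -> minset (vertex_cover E) (~: nth set0 s k).
  by move=> sk; rewrite -facets_independence_complex -/D -sD mem_nth.
have neq : ~: nth set0 s i != ~: nth set0 s j.
  by rewrite (inj_eq (@setC_inj _)) nth_uniq // neq_ltn ij.
have [x [C [Cmin ltC xD Cx]]] := cover_exchange (min i si) (min j js) neq (sle i j (ltnW ij) si js).
have Cs : ~: C \in s by rewrite sD /D facets_independence_complex setCK.
exists x, (index (~: C) s); split.
- by move: xD; rewrite !inE negbK andbC.
- rewrite ltnNge; apply: contraL ltC => jC; rewrite -leqNgt.
  by have := sle _ _ jC js; rewrite index_mem nth_index // /le setCK; apply.
- by rewrite nth_index // -Cx !setDE !setCK setIC.
Qed.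

Lemma independence_complex_pure_shellable :
  pure_shellable_complex (independence_complex E).
Proof.
split; last exact: independence_complex_shellable.
- move=> F F'; rewrite !inE => /forall_inP ind F'F; apply/forall_inP => e eE.
  by apply: contra (ind e eE) => /subset_trans->.
- move=> F F'; rewrite !facets_independence_complex => /cover_card cF /cover_card cF'.
  by apply: (@addnI #|~: F|); rewrite [LHS]addnC cardsC cF -cF' addnC cardsC.
Qed.

End NestedTraces.

(** * Perfect elimination and cliques *)

Section Colouring.
Variables (T : finType) (G : rel T).
Hypothesis Gsym : ssrbool.symmetric G.

Lemma cliqueP Q : reflect (Q != set0 /\ {in Q &, forall x y, x != y -> G x y}) (clique G Q).
Proof.
apply: (iffP andP) => -[Q0 QG]; split=> //.
  by move=> x y xQ yQ; apply/implyP/(forall_inP (forall_inP QG x xQ)).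
by apply/forall_inP => x xQ; apply/forall_inP => y yQ; apply/implyP/QG.
Qed.

Lemma colourableP k :
  reflect (exists c : {ffun T -> 'I_k}, forall x y, x != y -> G x y -> c x != c y)
          (colourable G k).
Proof.
apply: (iffP existsP) => -[c cG]; exists c.
  by move=> x y xy Gxy; have /forallP/(_ y)/implyP := forallP cG x; apply; rewrite xy.
by apply/forallP => x; apply/forallP => y; apply/implyP => /andP[xy /cG->].
Qed.

(** A colouring is injective on each clique. *)
Lemma clique_number_min_colours k : colourable G k -> clique_number G <= k.
Proof.
move=> /colourableP[c cG]; apply/bigmax_leqP => Q /cliqueP[_ QG].
rewrite -[k]card_ord -(card_in_imset (f := c)) ?max_card // => x y xQ yQ cxy.
by apply: contraTeq isT => xy; have := cG _ _ xy (QG x y xQ yQ xy); rewrite cxy eqxx.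
Qed.

Lemma chromatic_number_colourable : colourable G (chromatic_number G).
Proof. by rewrite /chromatic_number; case: ex_minnP. Qed.

Variable p : T -> nat.
Hypothesis p_inj : injective p.

(** Vertices are coloured from the last to the first; each one has fewer than
    [k] neighbours that are already coloured. *)
Lemma greedy_colouring k :
  (forall x, #|[set y | G x y & p x < p y]| < k) -> colourable G k.
Proof.
move=> later; have main (S : {set T}) :
    (forall x y, x \in S -> p x < p y -> y \in S) ->
    exists c : T -> 'I_k, {in S &, forall x y, x != y -> G x y -> c x != c y}.
  have [m] := ubnP #|S|; elim: m S => // m IH S cardS up.
  have [->|/set0Pn[v0 v0S]] := eqVneq S set0.
    by exists (fun x => Ordinal (leq_ltn_trans (leq0n _) (later x))) => x y; rewrite inE.
  have [v vS vmin] := @arg_minnP _ v0 (mem S) p v0S; have {}vS : v \in S by [].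
  have later_v x : x \in S -> x != v -> p v < p x.
    by move=> xS xv; rewrite ltn_neqAle vmin // (inj_eq p_inj) eq_sym xv.
  have [||c cS] := IH (S :\ v).
  - by rewrite (cardsD1 v) vS in cardS.
  - move=> x y; rewrite !inE => /andP[xv xS] xy; rewrite (up x) // andbT.
    by apply: contraTneq xy => ->; rewrite -leqNgt ltnW ?later_v.
  have [a aP] : exists a, a \notin [set c y | y in [set y | G v y & p v < p y]].
    apply/existsP; apply: contraT; rewrite negb_exists => /forallP all_used.
    have := later v; rewrite ltnNge => /negP[]; rewrite -[k]card_ord.
    apply: leq_trans (leq_imset_card c _); apply/subset_leq_card/subsetP => a _.
    by have := all_used a; rewrite negbK.
  have new x : x \in S -> x != v -> G v x -> c x != a.
    move=> xS xv Gvx; apply: contraNneq aP => <-; apply: imset_f.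
    by rewrite inE Gvx later_v.
  exists (fun x => if x == v then a else c x) => x y xS yS xy Gxy.
  have [xv|xv] := eqVneq x v; have [yv|yv] := eqVneq y v.
  - by rewrite xv yv eqxx in xy.
  - by rewrite eq_sym new // -xv.
  - by rewrite new // -yv Gsym.
  - by apply: cS => //; rewrite !inE ?xv ?yv.
have [//|c cG] := main setT.
by apply/colourableP; exists (finfun c) => x y xy Gxy; rewrite !ffunE cG ?inE.
Qed.

(** A vertex together with its later neighbours is a clique, so the greedy
    colouring uses at most [clique_number G] colours. *)
Lemma elimination_chromatic_number :
    (forall x y z, G x y -> G x z -> p x < p y -> p x < p z -> y != z -> G y z) ->
  chromatic_number G = clique_number G.
Proof.
move=> elim_p; rewrite /chromatic_number; case: ex_minnP => k kcol kmin.
apply/eqP; rewrite eqn_leq clique_number_min_colours // andbT; apply: kmin.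
apply: greedy_colouring => x; set L := [set y | _ & _].
have xL : x \notin L by rewrite inE ltnn andbF.
have := @leq_bigmax_cond _ (clique G) (fun Q : {set T} => #|Q|) (x |: L).
rewrite cardsU1 xL; apply; apply/cliqueP; split.
  by apply/set0Pn; exists x; rewrite setU11.
move=> y z /setU1P[->|]; last rewrite inE => /andP[Gxy xy].
  by case/setU1P=> [->|]; rewrite ?eqxx // inE => /andP[].
case/setU1P=> [-> _|]; first by rewrite Gsym.
by rewrite inE => /andP[Gxz xz]; apply: (elim_p x).
Qed.

End Colouring.

Lemma perfect_elimination (T : finType) (G : rel T) (p : T -> nat) :
    ssrbool.symmetric G -> injective p ->
    (forall x y z, G x y -> G x z -> p x < p y -> p x < p z -> y != z -> G y z) ->
  perfect G.
Proof.
move=> Gsym p_inj elim_p A.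
apply: (@elimination_chromatic_number _ _ _ (p \o val)) => [x y|x y|x y z].
- exact: Gsym.
- by move=> /p_inj/val_inj.
- exact: elim_p.
Qed.

Definition two_section (T : finType) (E : {set {set T}}) : rel T :=
  fun x y => (x != y) && [exists e in E, (x \in e) && (y \in e)].

Section TwoSection.
Variables (n : nat) (E : {set {set 'I_n}}).
Hypotheses (hclutter : is_clutter E) (E0 : set0 \notin E).
Hypotheses (hbalanced : totally_balanced E).
Hypothesis hisolated : forall x, ~~ isolated_vertex E x.

Lemma two_section_simple : simple_graph (two_section E).
Proof.
split=> [x y|x]; last by rewrite /two_section eqxx.
rewrite /two_section eq_sym; congr (_ && _).
by apply: eq_existsb => e; rewrite [(x \in e) && _]andbC.
Qed.

(** Of two edges through [x], the one coming last in [q] contains every later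
    vertex of the other. *)
Lemma two_section_elimination :
  exists2 p : 'I_n -> nat, injective p & forall x y z,
    two_section E x y -> two_section E x z -> p x < p y -> p x < p z -> y != z ->
    two_section E y z.
Proof.
have [p [q [p_inj q_inj gamma]]] := gamma_free_order hbalanced.
exists p => // x y z /andP[xy /exists_inP[e eE /andP[xe ye]]].
case/andP=> xz /exists_inP[f fE /andP[xf zf]] ltxy ltxz yz.
rewrite /two_section yz; apply/exists_inP.
have [lt_ef|lt_fe|/q_inj ef] := ltngtP (q e) (q f).
- by exists f => //; rewrite zf (gamma x y e f).
- by exists e => //; rewrite ye (gamma x z f e).
- by exists e => //; rewrite ye ef zf.
Qed.

Lemma two_section_perfect : perfect (two_section E).
Proof.
have [p p_inj elim_p] := two_section_elimination.
by apply: perfect_elimination elim_p; have [] := two_section_simple.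
Qed.

Lemma edge_clique e : e \in E -> clique (two_section E) e.
Proof.
move=> eE; apply/cliqueP; split; first by apply: contraNneq E0 => <-.
by move=> x y xe ye xy; rewrite /two_section xy; apply/exists_inP; exists e; rewrite ?xe.
Qed.

(** For distinct [x], [y], [z] in [Q], the smaller cliques [Q :\ x], [Q :\ y] and
    [Q :\ z] lie in edges by induction; if none of these contains all of [Q],
    they form a 3-cycle on [x], [y], [z]. *)
Lemma clique_sub_edge Q : clique (two_section E) Q -> exists2 e, e \in E & Q \subset e.
Proof.
have [m] := ubnP #|Q|; elim: m Q => // m IH Q cardQ /cliqueP[/set0Pn[x xQ] QG].
have sub_clique y z : y \in Q -> z \in Q -> z != y ->
    exists2 e, e \in E & Q :\ y \subset e.
  move=> yQ zQ zy; apply: IH; first by rewrite (cardsD1 y) yQ in cardQ.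
  apply/cliqueP; split; first by apply/set0Pn; exists z; rewrite !inE zy.
  by move=> u v; rewrite !inE => /andP[_ uQ] /andP[_ vQ]; apply: QG.
have [y /andP[yQ yx]|Q1] := pickP [pred y | (y \in Q) && (y != x)]; last first.
  have := hisolated x; rewrite negb_forall_in => /exists_inP[e eE].
  rewrite negbK => xe; exists e => //; apply/subsetP => y yQ.
  by have := Q1 y; rewrite /= yQ => /negbFE/eqP->.
have [z /and3P[zQ zx zy]|Q2] := pickP [pred z | [&& z \in Q, z != x & z != y]]; last first.
  have /andP[_ /exists_inP[e eE /andP[ye xe]]] := QG y x yQ xQ yx.
  exists e => //; apply/subsetP => z zQ.
  by have /negbT := Q2 z; rewrite /= zQ /= negb_and !negbK => /orP[]/eqP->.
have xy : x != y by rewrite eq_sym.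
have xz : x != z by rewrite eq_sym.
have [ex exE Qx] := sub_clique x y xQ yQ yx.
have [ey eyE Qy] := sub_clique y z yQ zQ zy.
have [ez ezE Qz] := sub_clique z x zQ xQ xz.
have [xex|xex] := boolP (x \in ex).
  by exists ex => //; rewrite -(setD1K xQ) subUset sub1set xex.
have [yey|yey] := boolP (y \in ey).
  by exists ey => //; rewrite -(setD1K yQ) subUset sub1set yey.
have [zez|zez] := boolP (z \in ez).
  by exists ez => //; rewrite -(setD1K zQ) subUset sub1set zez.
by case: (@no_3cycle n E hbalanced x y z ez ex ey) => //;
  rewrite ?(subsetP Qx) ?(subsetP Qy) ?(subsetP Qz) // !inE ?xQ ?yQ ?zQ ?andbT // eq_sym.
Qed.

Lemma two_section_maximal_cliques : E = maximal_clique_clutter (two_section E).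
Proof.
apply/setP => e; rewrite inE; apply/idP/maxsetP => [eE | [eG emax]].
  split=> [|Q QG eQ]; first exact: edge_clique.
  have [f fE Qf] := clique_sub_edge QG.
  have ef : e = f by apply: hclutter => //; apply: subset_trans Qf.
  by apply/eqP; rewrite eqEsubset eQ ef Qf.
have [f fE ef] := clique_sub_edge eG.
by rewrite -(emax f (edge_clique fE) ef).
Qed.

(** All edges have size [clique_number G], which is also the number of colours of
    an optimal colouring of the two-section; so each edge carries every colour
    exactly once, and the colour classes are the parts. *)
Lemma uniform_transversal_partition : uniform E ->
  exists P : {set {set 'I_n}}, partition P [set: 'I_n] /\
    (forall (f B : {set 'I_n}), f \in E -> B \in P -> #|f :&: B| = 1).
Proof.
move=> huniform; pose G := two_section E.
have edge_size f : f \in E -> #|f| = clique_number G.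
  move=> fE; apply/eqP; rewrite eqn_leq.
  rewrite (@leq_bigmax_cond _ (clique G) (fun Q : {set 'I_n} => #|Q|)) ?edge_clique //=.
  apply/bigmax_leqP => Q /clique_sub_edge[e eE Qe].
  by rewrite (huniform f e) // subset_leq_card.
have /colourableP[c cG] : colourable G (clique_number G).
  have [p p_inj elim_p] := two_section_elimination; have [Gsym _] := two_section_simple.
  by rewrite -(elimination_chromatic_number Gsym p_inj elim_p) chromatic_number_colourable.
exists (preim_partition c setT); split; first exact: preim_partitionP.
move=> f B fE /imsetP[x _ ->].
have c_inj : {in f &, injective c}.
  move=> y z yf zf cyz; apply: contraTeq isT => yz.
  have /cliqueP[_ fG] := edge_clique fE.
  by have := cG y z yz (fG y z yf zf yz); rewrite cyz eqxx.
have : c x \in [set c y | y in f].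
  suff /eqP -> : [set c y | y in f] == setT by rewrite inE.
  by rewrite eqEcard subsetT cardsT card_ord card_in_imset // edge_size /=.
case/imsetP=> y yf cxy; apply/eqP/cards1P; exists y; apply/setP => z.
rewrite !inE /= cxy; apply/andP/eqP => [[zf /eqP/c_inj->//]|->].
by rewrite yf eqxx.
Qed.

End TwoSection.

(** * The structure theorem *)

Lemma unmixed_konig_matching n (E : {set {set 'I_n}}) :
    totally_balanced E -> unmixed E -> set0 \notin E ->
  exists M : {set {set 'I_n}}, [/\ M \subset E, trivIset M
              & forall C, minset (vertex_cover E) C -> #|C| = #|M|].
Proof.
move=> hbalanced hunmixed E0; have [p [q [p_inj q_inj gamma]]] := gamma_free_order hbalanced.
have [M [C [ME trivM Ccov leCM]]] := greedy_matching p_inj q_inj gamma E0.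
exists M; split=> // D Dmin; have [C0 C0min C0C] := vertex_cover_minset Ccov.
rewrite (hunmixed D C0) //; apply/eqP; rewrite eqn_leq (leq_trans (subset_leq_card C0C)) //.
by have [C0cov _] := minsetP C0min; rewrite (matching_leq_cover ME trivM).
Qed.

Theorem corollary2p20 (K : fieldType) (n : nat) (E : {set {set 'I_n}}) (g : nat)
    (hclutter : is_clutter E) (hunmixed : unmixed E)
    (hbalanced : totally_balanced E)
    (hisolated : forall x : 'I_n, ~~ isolated_vertex E x)
    (hg : ideal_height (edge_ideal (K := K) E) g) :
  exists e : 'I_g -> {set 'I_n},
    (* (a) *)
    (konig_perfect_matching K E e /\
     (forall i : 'I_g, exists2 x : 'I_n, x \in e i & free_vertex E x)) /\
    (* (b) *)
    pure_shellable_complex (independence_complex E) /\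
    (exists G : rel 'I_n,
       (* (c) *)
       [/\ simple_graph G, perfect G & E = maximal_clique_clutter G] /\
       (* (d) *)
       (forall i : 'I_g, exists2 Q : {set 'I_n}, maximal_clique G Q &
          [set x in e i | ~~ free_vertex E x] \subset Q)) /\
    (* (e) *)
    (uniform E ->
       exists P : {set {set 'I_n}}, partition P [set: 'I_n] /\
         (forall (f B : {set 'I_n}), f \in E -> B \in P -> #|f :&: B| = 1)).
Proof.
have E0 := edge_ideal_height_set0 hg.
have [M [ME trivM cover_card]] := unmixed_konig_matching hbalanced hunmixed E0.
have gM : g = #|M|.
  have Tcov : vertex_cover E setT.
    by apply/forall_inP => e eE; rewrite setTI; apply: contraNneq E0 => <-.
  have [C Cmin _] := vertex_cover_minset Tcov; have [Ccov _] := minsetP Cmin.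
  rewrite -(cover_card C Cmin); apply: edge_ideal_height_cover hg Ccov _ => D Dcov.
  by rewrite (cover_card C Cmin) (matching_leq_cover ME trivM).
have coverM := perfect_matching hclutter ME trivM cover_card hisolated.
pose e (i : 'I_g) : {set 'I_n} := enum_val (cast_ord gM i).
have eM i : e i \in M by apply: enum_valP.
have eE i : e i \in E by apply: (subsetP ME).
exists e; split; [|split; [|split]].
- split; last first.
    by move=> i; apply: matching_free_vertex E0 (eM i).
  split=> // [i j ij|].
    apply: (trivIsetP trivM) => //; apply: contraNneq ij => /enum_val_inj/cast_ord_inj->.
    by rewrite eqxx.
  apply/setP => x; rewrite -coverM; apply/bigcupP/bigcupP => [[i _ xi]|[f fM xf]].
    by exists (e i).
  exists (cast_ord (esym gM) (enum_rank_in fM f)) => //.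
  by rewrite /e cast_ordKV enum_rankK_in.
- exact: (independence_complex_pure_shellable hclutter hbalanced ME trivM cover_card).
- have maxE := two_section_maximal_cliques hclutter E0 hbalanced hisolated.
  exists (two_section E); split.
    by split; [apply: two_section_simple | apply: two_section_perfect | ].
  (* The edge itself, being a maximal clique, contains its non-free vertices. *)
  move=> i; exists (e i); first by have := eE i; rewrite {1}maxE inE.
  by apply/subsetP => x; rewrite inE => /andP[].
- exact: uniform_transversal_partition.
Qed.
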